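(* Let $A=[A_1,\dots,A_n]\in\mathbb{R}^{N\times N}$ with $A_i\in\mathbb{R}^{N\times d_i}$, $\sum_{i=1}^n d_i=N$, be a non-singular square matrix, and let $b\in\mathbb{R}^N$. Let $y^k=[x^k;\mu^k]\in\mathbb{R}^{2N}$ be the iterates of randomly permuted ADMM (RP-ADMM, defined in the context, with $\beta=1$) applied to the problem $\min_{x\in\mathbb{R}^N} 0$ subject to $A_1x_1+\cdots+A_nx_n=b$, started from an arbitrary (deterministic) initial point $y^0$. Let $\phi^k=E(y^k)$, the expectation being over the random permutations used before $y^k$ is produced. Then the expected output converges to the unique primal-dual optimal solution of the problem, i.e. $$\lim_{k\to\infty}\phi^k=\begin{bmatrix}A^{-1}b\\ 0\end{bmatrix}.$$
   Context: Write $x=[x_1;\dots;x_n]$ with $x_i\in\mathbb{R}^{d_i}$, and $\mu\in\mathbb{R}^N$. The augmented Lagrangian (with $\beta=1$) is $\mathcal{L}(x_1,\dots,x_n;\mu)=-\mu^T(Ax-b)+\frac12\|Ax-b\|^2$. RP-ADMM: in each round $k=0,1,2,\dots$, draw a permutation $\sigma=\sigma_k$ of $\{1,\dots,n\}$ uniformly at random, independently of the previous rounds. Then for $i=1,\dots,n$ in this order, set $x_{\sigma(i)}^{k+1}$ to be the minimizer over $x_{\sigma(i)}\in\mathbb{R}^{d_{\sigma(i)}}$ of $\mathcal{L}(\cdot\,;\mu^k)$, where blocks $\sigma(1),\dots,\sigma(i-1)$ are fixed at their new values $x^{k+1}_{\sigma(1)},\dots,x^{k+1}_{\sigma(i-1)}$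 and blocks $\sigma(i+1),\dots,\sigma(n)$ are fixed at their old values $x^k_{\sigma(i+1)},\dots,x^k_{\sigma(n)}$. Finally set $\mu^{k+1}=\mu^k-(\sum_{i=1}^nA_ix_i^{k+1}-b)$. The primal-dual optimal solution of the problem is $(x,\mu)=(A^{-1}b,0)$. *)

(* Defs.v *)
From HB Require Import structures.
From mathcomp Require Import all_boot all_order all_algebra all_fingroup.
From mathcomp Require Import all_classical all_reals all_analysis.

Set Implicit Arguments.
Unset Strict Implicit.
Unset Printing Implicit Defensive.

Import Order.TTheory GRing.Theory Num.Theory.
Import numFieldNormedType.Exports.
Local Open Scope classical_set_scope.
Local Open Scope ring_scope.

Section Optimization.
Context {R : realType} {m p : nat}.
Implicit Types (f : 'cV[R]_p -> R) (A : 'M[R]_(m, p)) (b mu : 'cV[R]_m)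
  (x : 'cV[R]_p).

(* The matrix norm of MathComp-Analysis is the sup norm. *)
Definition sqnorm2 (v : 'cV[R]_m) : R := \sum_i v i 0 ^+ 2.

(* For the problem: minimize f x subject to A x = b. *)
Definition lagrangian f A b x mu : R :=
  f x - (mu^T *m (A *m x - b)) 0 0.

(* Penalty parameter beta = 1. *)
Definition aug_lagrangian f A b x mu : R :=
  lagrangian f A b x mu + 2^-1 * sqnorm2 (A *m x - b).

Definition primal_optimal f A b x : Prop :=
  A *m x = b /\ forall x', A *m x' = b -> f x <= f x'.

Definition dual_function f A b mu : \bar R :=
  ereal_inf [set (lagrangian f A b x mu)%:E | x in [set: 'cV[R]_p]].

Definition dual_optimal f A b mu : Prop :=
  forall mu', (dual_function f A b mu' <= dual_function f A b mu)%E.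

Definition primal_dual_optimal f A b x mu : Prop :=
  primal_optimal f A b x /\ dual_optimal f A b mu.

(* A global minimizer of F; the junk value 0 if there is none. *)
Definition argmin (F : 'cV[R]_p -> R) : 'cV[R]_p :=
  xget 0 [set v | forall u, F v <= F u].

End Optimization.

(* A vector x = [x_1; ...; x_n] with x_i of dimension d i is an element of
   'cV_(\sum_i d i) whose i-th block is submxcol x i. *)
Section RPADMM.
Context {R : realType} {n : nat} {d : 'I_n -> nat}.
Let N := (\sum_i d i)%N.
Variables (f : 'cV[R]_N -> R) (A : 'M[R]_N) (b : 'cV[R]_N).

Definition set_block (x : 'cV[R]_N) (i : 'I_n) (v : 'cV[R]_(d i)) : 'cV[R]_N :=
  \mxcol_(j < n) dfwith (fun k => submxcol x k) i v j.

Definition minimize_block (mu x : 'cV[R]_N) (i : 'I_n) : 'cV[R]_N :=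
  set_block x (argmin (fun v : 'cV[R]_(d i) =>
    aug_lagrangian f A b (set_block x v) mu)).

(* Gauss-Seidel sweep over the blocks s 0, s 1, ..., s (n - 1). *)
Definition sweep (s : 'S_n) (mu x : 'cV[R]_N) : 'cV[R]_N :=
  foldl (minimize_block mu) x [seq s i | i <- enum 'I_n].

Definition admm_round (s : 'S_n) (y : 'cV[R]_(N + N)) : 'cV[R]_(N + N) :=
  let x' := sweep s (dsubmx y) (usubmx y) in
  col_mx x' (dsubmx y - (A *m x' - b)).

Fixpoint rp_admm (s : nat -> 'S_n) (y0 : 'cV[R]_(N + N)) (k : nat) :
    'cV[R]_(N + N) :=
  if k is k'.+1 then admm_round (s k') (rp_admm s y0 k') else y0.

End RPADMM.

Section RandomPermutations.
Context {R : realType} {disp : measure_display} {T : measurableType disp}.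
Context (P : probability T R) {n : nat}.

Definition uniform_perm (sigma : T -> 'S_n) : Prop :=
  forall s : 'S_n, measurable (sigma @^-1` [set s]) /\
    P (sigma @^-1` [set s]) = ((n`!%:R)^-1)%:E.

Definition independent_perms (sigma : nat -> T -> 'S_n) : Prop :=
  forall (J : seq nat) (B : nat -> set 'S_n), uniq J ->
    P (\bigcap_(k in [set` J]) (sigma k @^-1` B k)) =
    (\prod_(k <- J) P (sigma k @^-1` B k))%E.

Definition expectation_vec {m : nat} (Y : T -> 'cV[R]_m) : 'cV[R]_m :=
  \col_j fine ('E_P[fun w => Y w j 0%R])%E.

End RandomPermutations.

(* Main.v *)
Require Import Defs.
From HB Require Import structures.
From mathcomp Require Import all_boot all_order all_algebra all_fingroup.
From mathcomp Require Import all_classical all_reals all_analysis.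
From mathcomp Require Import ring lra.

Import Order.TTheory GRing.Theory Num.Theory.
Import numFieldNormedType.Exports.
Local Open Scope classical_set_scope.
Local Open Scope ring_scope.

(** The mean iteration is governed by a single symmetric matrix C, and the
    theorem holds because the spectrum of C lies in the open interval from
    -1/3 to 1.

    Reduction to C. Put w = A x - b - mu. Up to a term that depends on mu
    alone, the augmented Lagrangian is half of the squared norm of w, so
    minimizing it over block i replaces w by Q_i w, where Q_i is the orthogonal
    projection onto the complement of the range of A_i
    ([minimize_block_residual]). A round with permutation s therefore replaces
    w by Pi_s w with Pi_s = Q_(s (n-1)) ... Q_(s 0), and ends with
    A x' - b = mu + Pi_s w and mu' = - Pi_s w. This is affine in (x, mu), and
    s is independent of the past, so the means obey the same recursion with
    Pi_s replaced by its average C over all permutations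
    ([expectation_vec_iter], [mean_admm_round]).

    Spectrum of C ([perm_avg_sandwich]). C is symmetric because reversing a
    permutation transposes the product of the projections. The bounds go by
    induction on the set of projections: C is the average over i of Q_i C_i,
    where C_i is the average over the orderings of the other projections. If
    -1/3 <= C_i <= 1, then C_i - 1/3 has operator norm at most 2/3; hence, for
    a unit vector v and s = |Q_i v|, the number <v, Q_i C_i v> lies between
    (s^2 - 2 s) / 3 >= -1/3 and (s^2 + 2 s) / 3 <= 1, and both final bounds are
    strict unless s = 1, that is, unless Q_i v = v ([orthoproj_sandwich]). As A
    is nonsingular, no nonzero vector is fixed by every Q_i.

    Convergence. Eliminating x leaves mu_(k+2) = 2 C mu_(k+1) - C mu_k. On an
    eigenvector of C with eigenvalue c the characteristic polynomial is
    X^2 - 2 c X + c, whose roots lie in the open unit disk exactly when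
    -1/3 < c < 1. No diagonalization is needed: a quadratic energy decreases
    along the recursion by the value of the form 1 - C at mu_k - mu_(k+2)
    ([energy_decr]), so these differences tend to 0, and then so does mu_k
    ([two_step_cvg0]). Finally A x_(k+1) - b = mu_k - mu_(k+1) tends to 0. *)

Set Implicit Arguments.
Unset Strict Implicit.
Unset Printing Implicit Defensive.

(** * The standard inner product *)

Section InnerProduct.
Context {R : realFieldType}.

Definition dot {m : nat} (u v : 'cV[R]_m) : R := (u^T *m v) 0 0.

Lemma dotE m (u v : 'cV[R]_m) : dot u v = \sum_i u i 0 * v i 0.
Proof. by rewrite /dot mxE; apply: eq_bigr => i _; rewrite mxE. Qed.

Lemma dotC m (u v : 'cV[R]_m) : dot u v = dot v u.
Proof. by rewrite !dotE; apply: eq_bigr => i _; rewrite mulrC. Qed.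

Lemma dotDr m (u v w : 'cV[R]_m) : dot u (v + w) = dot u v + dot u w.
Proof. by rewrite /dot mulmxDr mxE. Qed.

Lemma dotDl m (u v w : 'cV[R]_m) : dot (u + v) w = dot u w + dot v w.
Proof. by rewrite dotC dotDr !(dotC w). Qed.

Lemma dotZr m a (u v : 'cV[R]_m) : dot u (a *: v) = a * dot u v.
Proof. by rewrite /dot -scalemxAr mxE. Qed.

Lemma dotZl m a (u v : 'cV[R]_m) : dot (a *: u) v = a * dot u v.
Proof. by rewrite dotC dotZr dotC. Qed.

Lemma dotNr m (u v : 'cV[R]_m) : dot u (- v) = - dot u v.
Proof. by rewrite /dot mulmxN mxE. Qed.

Lemma dotNl m (u v : 'cV[R]_m) : dot (- u) v = - dot u v.
Proof. by rewrite dotC dotNr dotC. Qed.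

Lemma dot0r m (u : 'cV[R]_m) : dot u 0 = 0.
Proof. by rewrite /dot mulmx0 mxE. Qed.

Lemma dot_mulmxr m p (M : 'M[R]_(m, p)) (u : 'cV[R]_m) (v : 'cV[R]_p) :
  dot u (M *m v) = dot (M^T *m u) v.
Proof. by rewrite /dot trmx_mul trmxK mulmxA. Qed.

Lemma dot_sumr m (I : Type) (r : seq I) (F : I -> 'cV[R]_m) (u : 'cV[R]_m) :
  dot u (\sum_(i <- r) F i) = \sum_(i <- r) dot u (F i).
Proof. by rewrite /dot mulmx_sumr summxE. Qed.

Lemma dot_ge0 m (u : 'cV[R]_m) : 0 <= dot u u.
Proof. by rewrite dotE; apply: sumr_ge0 => i _; rewrite -expr2 sqr_ge0. Qed.

Lemma dot_eq0 m (u : 'cV[R]_m) : (dot u u == 0) = (u == 0).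
Proof.
apply/eqP/eqP => [|->]; last exact: dot0r.
rewrite dotE => /eqP; rewrite psumr_eq0 => [/allP u0|i _]; last first.
  by rewrite -expr2 sqr_ge0.
apply/matrixP => i j; rewrite ord1 mxE.
by have := u0 i; rewrite mem_index_enum mulf_eq0 orbb => /(_ isT) /eqP.
Qed.

Definition dot_linear := (mulmxDr, mulmxDl, mulmxN, mulNmx,
  @dotDr, @dotDl, @dotNr, @dotNl, @dotZr, @dotZl).

End InnerProduct.

(** * Left multiplication by a projection *)

Section ContractionStep.
Context {R : realFieldType} {m : nat}.
Implicit Types (C Q : 'M[R]_m) (u v : 'cV[R]_m).

(** Symmetric with spectrum in the interval from -1/3 to 1; stated with the
    quadratic form, so that no spectral theorem is involved. *)
Definition sandwiched C := C^T = C /\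
  forall v, - (3^-1 * dot v v) <= dot v (C *m v) <= dot v v.

Definition orthoproj Q := Q^T = Q /\ Q *m Q = Q.

Lemma orthoproj_dot Q v : orthoproj Q -> dot (Q *m v) v = dot (Q *m v) (Q *m v).
Proof. by move=> [Qsym Qid]; rewrite dot_mulmxr Qsym mulmxA Qid. Qed.

Lemma orthoproj_le Q v : orthoproj Q ->
  dot (Q *m v) (Q *m v) <= dot v v ?= iff (Q *m v == v).
Proof.
move=> Qproj; have := dot_ge0 (v - Q *m v).
have E : dot (v - Q *m v) (v - Q *m v) = dot v v - dot (Q *m v) (Q *m v).
  by rewrite !dot_linear (dotC v (Q *m v)) orthoproj_dot//; ring.
rewrite E => ge0; split; first by rewrite -subr_ge0.
rewrite -[RHS](inj_eq oppr_inj) -subr_eq0 opprK addrC -dot_eq0 E.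
by rewrite subr_eq0 eq_sym.
Qed.

Lemma polarization C u v : C^T = C ->
  dot (u + v) (C *m (u + v)) - dot (u - v) (C *m (u - v)) = 4 * dot u (C *m v).
Proof.
move=> Csym; have E : dot v (C *m u) = dot u (C *m v).
  by rewrite dot_mulmxr Csym dotC.
by rewrite !dot_linear E; ring.
Qed.

(** The induction step for the spectral bounds. Write q = Q v, s = <q, q> and
    u = <v, v>, so that <q, v> = s as well. By polarization
    4 t <q, C v> is the difference of the values of C at q + t v and q - t v,
    which the bounds on C estimate from both sides without any square root.
    The upper bound takes t = 1. For t = 1 the lower estimate is
    - u / 3, which no longer depends on s; if s < u, moving t from 1 towards
    s / u improves it, hence the strict inequality. *)
Lemma orthoproj_sandwich C Q v : sandwiched C -> orthoproj Q ->
  [/\ - (3^-1 * dot v v) <= dot v (Q *m C *m v) <= dot v v &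
      Q *m v != v ->
      - (3^-1 * dot v v) < dot v (Q *m C *m v) < dot v v].
Proof.
move=> [Csym Cbd] Qproj.
have E : dot v (Q *m C *m v) = dot (Q *m v) (C *m v).
  by rewrite -mulmxA dot_mulmxr Qproj.1.
set q := Q *m v in E *.
have qv : dot q v = dot q q := orthoproj_dot v Qproj.
have s_le_u : dot q q <= dot v v by have [] := orthoproj_le v Qproj.
have s_lt_u : q != v -> dot q q < dot v v.
  by rewrite /q => nqv; rewrite (lt_leif (orthoproj_le v Qproj)).
have s0 := dot_ge0 q.
have upper : 3 * dot q (C *m v) <= 2 * dot q q + dot v v.
  have := polarization q v Csym; have /andP[_] := Cbd (q + v).
  have /andP[] := Cbd (q - v); rewrite !dot_linear (dotC v q) qv; lra.
have lower t : - (dot q q + t ^+ 2 * dot v v - t * dot q q) <=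
    3 * (t * dot q (C *m v)).
  have := polarization q (t *: v) Csym; have /andP[_] := Cbd (q - t *: v).
  have /andP[+ _] := Cbd (q + t *: v).
  rewrite -scalemxAr (dotZr t q (C *m v)).
  rewrite !(dotDl, dotDr, dotNl, dotNr, dotZl, dotZr) (dotC v q) qv; lra.
rewrite E; split=> [|qneqv]; first by have := lower 1; lra.
have {}s_lt_u := s_lt_u qneqv.
have u0 : 0 < dot v v by lra.
apply/andP; split; last lra.
(* Any t strictly between s / u and 1 works; this is their midpoint. *)
set t := (dot q q + dot v v) / (2 * dot v v).
have tu : t * dot v v = (dot q q + dot v v) / 2.
  by rewrite /t; field; rewrite lt0r_neq0.
have t0 : 0 < t by rewrite divr_gt0//; lra.
rewrite -(ltr_pM2l t0) -(ltr_pM2l (_ : 0 < 3)) //.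
have t1 : t < 1 by rewrite -(ltr_pM2r u0) tu; lra.
apply: lt_le_trans (lower t); rewrite expr2 -mulrA tu; nra.
Qed.

End ContractionStep.

(** * Averages of products of projections over all orderings *)

Section PermAverage.
Context {R : realFieldType} {m : nat} {I : eqType}.
Variable Q : I -> 'M[R]_m.
Implicit Types l t : seq I.

Definition perm_avg l : 'M[R]_m :=
  (size l)`!%:R^-1 *: \sum_(t <- permutations l) \prod_(i <- t) Q i.

(** An ordering of l is a first element x followed by an ordering of the
    rest. *)
Lemma perm_avg_cons l : uniq l -> l != [::] ->
  perm_avg l = (size l)%:R^-1 *: \sum_(x <- l) Q x *m perm_avg (rem x l).
Proof.
move=> ul l0; have sz : (0 < size l)%N by rewrite lt0n size_eq0.
rewrite /perm_avg (perm_big _ (permutationsE sz)) undup_id//.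
rewrite big_allpairs_dep/= -(prednK sz) factS natrM invfM -scalerA.
congr (_ *: _).
rewrite scaler_sumr !big_seq; apply: eq_bigr => x xl.
rewrite size_rem// -scalemxAr; congr (_ *: _).
by rewrite mulmx_sumr; apply: eq_bigr => t _; rewrite big_cons.
Qed.

Lemma trmx_prod t : (forall i, (Q i)^T = Q i) ->
  (\prod_(i <- t) Q i)^T = \prod_(i <- rev t) Q i.
Proof.
move=> Qsym; elim: t => [|x t IH]; first by rewrite !big_nil trmx1.
by rewrite rev_cons -cats1 big_cat big_seq1 big_cons trmx_mul IH Qsym.
Qed.

(** Transposing a product of symmetric matrices reverses the order of the
    factors, and reversal permutes the set of all orderings. *)
Lemma trmx_perm_avg l : uniq l -> (forall i, (Q i)^T = Q i) ->
  (perm_avg l)^T = perm_avg l.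
Proof.
move=> ul Qsym; rewrite /perm_avg linearZ/=; congr (_ *: _).
rewrite raddf_sum/= (eq_bigr _ (fun t _ => trmx_prod t Qsym)).
rewrite -(big_map rev predT (fun t => \prod_(i <- t) Q i)).
apply: perm_big; apply: uniq_perm.
- by rewrite map_inj_uniq ?permutations_uniq//; exact: inv_inj revK.
- exact: permutations_uniq.
move=> t; rewrite -[t in LHS]revK mem_map; last exact: inv_inj revK.
by rewrite !mem_permutations perm_rev.
Qed.

(** The weak bounds for the orderings of the remaining projections suffice to
    get both the weak and the strict bounds for l: strictness appears in the
    last step, from any projection that moves v. *)
Lemma perm_avg_sandwich l : uniq l -> (forall i, orthoproj (Q i)) ->
  sandwiched (perm_avg l) /\
  forall v, has (fun i => Q i *m v != v) l ->
    - (3^-1 * dot v v) < dot v (perm_avg l *m v) < dot v v.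
Proof.
move=> + Qproj; have [k] := ubnP (size l); elim: k l => // k IH l szl ul.
have symm := trmx_perm_avg ul (fun i => (Qproj i).1).
have [->|l0] := eqVneq l [::].
  split=> [|v //]; split=> [|v].
    by apply: trmx_perm_avg => // i; have [] := Qproj i.
  rewrite /perm_avg/= big_seq1 big_nil invr1 scale1r mul1mx lexx andbT.
  by have := dot_ge0 v; lra.
have sz : (0 < size l)%N by rewrite lt0n size_eq0.
have sz0 : 0 < (size l)%:R :> R by rewrite ltr0n.
have step x v : x \in l ->
    - (3^-1 * dot v v) <= dot v (Q x *m perm_avg (rem x l) *m v) <= dot v v /\
    (Q x *m v != v ->
     - (3^-1 * dot v v) < dot v (Q x *m perm_avg (rem x l) *m v) < dot v v).
  move=> xl; have [|bnd _] := IH (rem x l) _ (rem_uniq x ul).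
    by rewrite size_rem// -ltnS prednK.
  by have [] := orthoproj_sandwich v bnd (Qproj x).
have avgE v : (size l)%:R * dot v (perm_avg l *m v) =
    \sum_(x <- l) dot v (Q x *m perm_avg (rem x l) *m v).
  rewrite perm_avg_cons// -scalemxAl dotZr mulVKf ?lt0r_neq0//.
  by rewrite mulmx_suml dot_sumr.
have sumc (c : R) : (size l)%:R * c = \sum_(x <- l) c.
  by rewrite big_const_seq count_predT iter_addr_0 mulr_natl.
split=> [|v /hasP[x xl Qxv]].
  split=> // v; rewrite -(ler_pM2l sz0) -(ler_pM2l sz0 _ (dot v v)) avgE !sumc.
  by apply/andP; split; rewrite big_seq [leRHS]big_seq;
    apply: ler_sum => x xl; have [/andP[]] := step x v xl.
rewrite -(ltr_pM2l sz0) -(ltr_pM2l sz0 _ (dot v v)) avgE !sumc.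
rewrite !(big_rem x xl)/=; have [_ /(_ Qxv)/andP[lo up]] := step x v xl.
by apply/andP; split; apply: ltr_leD => //; rewrite big_seq [leRHS]big_seq;
  apply: ler_sum => y /mem_rem yl; have [/andP[]] := step y v yl.
Qed.

End PermAverage.

(** The product over the reversed list is the matrix of a sweep, whose first
    projection is the rightmost factor. *)
Lemma perm_avg_enum (R : realFieldType) m n (Q : 'I_n -> 'M[R]_m) :
  perm_avg Q (enum 'I_n) =
  n`!%:R^-1 *: \sum_(s : 'S_n) \prod_(i <- rev [seq s i | i <- enum 'I_n]) Q i.
Proof.
rewrite /perm_avg size_enum_ord; congr (_ *: _).
rewrite -(big_map (fun s : 'S_n => rev [seq s i | i <- enum 'I_n]) predT
  (fun t => \prod_(i <- t) Q i)).
set h := (fun s : 'S_n => _).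
have hinj : injective h.
  move=> s1 s2 /(inv_inj revK) /eq_in_map hs; apply/permP => i.
  by apply: hs; rewrite mem_enum.
have hu : uniq [seq h s | s <- index_enum 'S_n].
  by rewrite map_inj_uniq ?index_enum_uniq.
apply/esym/perm_big/uniq_perm; rewrite ?permutations_uniq//.
apply: (uniq_min_size hu _ _).2 => [_ /mapP[s _ ->]|].
  rewrite mem_permutations /h perm_rev.
  apply: uniq_perm; rewrite ?enum_uniq//.
    by rewrite map_inj_uniq ?enum_uniq//; exact: perm_inj.
  move=> i; rewrite mem_enum -[i](permKV s) mem_map ?mem_enum//.
  exact: perm_inj.
rewrite size_permutations ?enum_uniq// size_enum_ord size_map.
by rewrite -sum1_size sum1_card card_Sn.
Qed.

(** * A two-step linear recursion *)

Lemma cvg_mx (T : topologicalType) m n (J : Type) (F : set_system J)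
    (FF : Filter F) (u : J -> 'M[T]_(m, n)) (M : 'M[T]_(m, n)) :
  (forall i j, u k i j @[k --> F] --> M i j) -> u @ F --> M.
Proof.
move=> uM A [P MP PA]; rewrite /nbhs/=.
have : \forall k \near F, forall i j, P i j (u k i j).
  by apply: filter_forall => i; apply: filter_forall => j; exact/uM/MP.
by apply: filterS => k Pk; exact: PA.
Qed.

Lemma cvg_mulmx (R : realType) m n (B : 'M[R]_(m, n)) (u : nat -> 'cV[R]_n) v :
  u @ \oo --> v -> B *m u k @[k --> \oo] --> B *m v.
Proof.
move=> uv; apply: cvg_mx => i j; rewrite mxE.
under eq_fun do rewrite mxE.
apply: cvg_big => [|l _]; first by move=> x; exact: add_continuous.
by apply: cvgMl_tmp; exact: cvg_comp uv (@coord_continuous R n 1 l j v).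
Qed.

Section PosDef.
Context {R : realType} {m : nat}.
Implicit Types (P : 'M[R]_m) (u v : 'cV[R]_m).

Definition posdef P := forall v, v != 0 -> 0 < dot v (P *m v).

Lemma posdef_unitmx P : posdef P -> P \in unitmx.
Proof.
move=> Ppos; rewrite -unitmx_tr -row_free_unit; apply: inj_row_free => v vP.
apply/eqP/negPn/negP => v0.
have := Ppos v^T; rewrite -[P]trmxK -trmx_mul vP trmx0 dot0r ltxx.
by rewrite -trmx0 (inj_eq trmx_inj) => /(_ v0).
Qed.

(** The form P is nonnegative at <v, P v> u - <u, P v> v. *)
Lemma posdef_CauchySchwarz P u v : P^T = P -> posdef P ->
  dot u (P *m v) ^+ 2 <= dot u (P *m u) * dot v (P *m v).
Proof.
move=> Psym Ppos; have [->|v0] := eqVneq v 0.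
  by rewrite mulmx0 !dot0r expr0n mulr0.
have Pge0 w : 0 <= dot w (P *m w).
  have [->|/Ppos/ltW//] := eqVneq w 0; by rewrite mulmx0 dot0r.
have a0 := Ppos v v0; rewrite -(ler_pM2l a0).
have := Pge0 (dot v (P *m v) *: u - dot u (P *m v) *: v).
have E : dot v (P *m u) = dot u (P *m v) by rewrite dot_mulmxr Psym dotC.
rewrite mulmxBr -!scalemxAr !dot_linear E; nra.
Qed.

(** By Cauchy-Schwarz for the form P, each coordinate <e, P u> of P u is
    controlled by the value of the form at u; so P u, and hence u, tends
    to 0. *)
Lemma posdef_cvg0 P (u : nat -> 'cV[R]_m) : P^T = P -> posdef P ->
  dot (u k) (P *m u k) @[k --> \oo] --> (0 : R) -> u @ \oo --> (0 : 'cV[R]_m).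
Proof.
move=> Psym Ppos h.
have Pu : P *m u k @[k --> \oo] --> (0 : 'cV[R]_m).
  apply: cvg_mx => i j; rewrite ord1 mxE {j}.
  set e : 'cV[R]_m := delta_mx i 0.
  have eE (w : 'cV[R]_m) : w i 0 = dot e w.
    by rewrite dotE (bigD1 i)//= big1 ?addr0 ?mxE ?eqxx ?mul1r// => l /negPf li;
      rewrite mxE li mul0r.
  under eq_fun do rewrite eE.
  apply/cvgr0Pnorm_lt => eps eps0.
  set c := dot e (P *m e).
  have c0 : 0 <= c.
    rewrite /c; have [->|/Ppos/ltW//] := eqVneq e 0.
    by rewrite mulmx0 dot0r.
  have d0 : 0 < eps ^+ 2 / (c + 1) by rewrite divr_gt0 ?exprn_gt0//; lra.
  move/cvgr0Pnorm_lt/(_ _ d0) : h; apply: filterS => k.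
  move/(le_lt_trans (ler_norm _)); rewrite ltr_pdivlMr; last lra.
  have := posdef_CauchySchwarz e (u k) Psym Ppos; rewrite -/c.
  have ge0 : 0 <= dot (u k) (P *m u k).
    have [->|/Ppos/ltW//] := eqVneq (u k) 0; by rewrite mulmx0 dot0r.
  move=> h1 h2; rewrite -(ltr_pXn2r (n := 2))// ?nnegrE// ?ltW//.
  rewrite real_normK ?num_real//; nra.
have := cvg_mulmx (B := invmx P) Pu; rewrite mulmx0.
by under eq_fun do rewrite mulKmx ?posdef_unitmx//.
Qed.

End PosDef.

(** If the sequence a, b, p, q obeys the recursion and its differences over two
    steps vanish, then a = 2 C b - C a and b = 2 C a - C b, and eliminating b
    gives (1 + 3 C) (1 - C) a = 0. The identity is this elimination with the
    differences a - p and b - q kept as error terms. *)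
Lemma two_step_defect (R : realFieldType) m (C : 'M[R]_m) (a b : 'cV[R]_m)
    (p := 2 *: (C *m b) - C *m a) (q := 2 *: (C *m p) - C *m b) :
  (1%:M + 3 *: C) *m (1%:M - C) *m a =
  (a - p) + C *m (a - p) - 4 *: (C *m (C *m (a - p))) + 2 *: (C *m (b - q)).
Proof.
rewrite /q /p -mulmxA mulmxBl mul1mx mulmxDl mul1mx -scalemxAl.
rewrite !(mulmxDr, mulmxN) -!scalemxAr !(mulmxDr, mulmxN) -!scalemxAr.
rewrite ?(mulmxDr, mulmxN) -?scalemxAr ?(mulmxDr, mulmxN) -?scalemxAr.
set x1 := C *m a; set x2 := C *m x1; set x3 := C *m x2.
set y1 := C *m b; set y2 := C *m y1; set y3 := C *m y2.
by move: x1 x2 x3 y1 y2 y3 => *; apply/colP => i; rewrite !mxE; ring.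
Qed.

Section TwoStepRecursion.
Context {R : realType} {m : nat}.
Variables (C : 'M[R]_m) (mu : nat -> 'cV[R]_m).
Hypothesis Csym : C^T = C.
Hypothesis Cbd : forall v, v != 0 ->
  - (3^-1 * dot v v) < dot v (C *m v) < dot v v.
Hypothesis mu_rec : forall k, mu k.+2 = 2 *: (C *m mu k.+1) - C *m mu k.

(** For scalars this is the Schur-Cohn form (1 + c) (a^2 + b^2) - 4 c a b of the
    polynomial X^2 - 2 c X + c; its Lyapunov decrement is a single square,
    which is why no eigenvector is needed in [energy_decr]. *)
Definition energy (a b : 'cV[R]_m) : R :=
  dot a a + dot b b + dot a (C *m a) + dot b (C *m b) - 4 * dot a (C *m b).

(** Twice the energy is the value of 1 + 3 C at a - b plus the value of 1 - C
    at a + b. *)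
Lemma energy_ge0 a b : 0 <= energy a b.
Proof.
have bd v : - (3^-1 * dot v v) <= dot v (C *m v) <= dot v v.
  have [->|/Cbd/andP[/ltW-> /ltW->]//] := eqVneq v 0.
  by rewrite mulmx0 dot0r mulr0 oppr0 lexx.
have E : dot b (C *m a) = dot a (C *m b) by rewrite dot_mulmxr Csym dotC.
have /andP[+ _] := bd (a - b); have /andP[_] := bd (a + b).
by rewrite /energy !dot_linear (dotC b a) E; lra.
Qed.

(** Every occurrence of 4 C a in the difference of the two energies can be
    replaced by 2 p + 2 C b, after which a disappears. *)
Lemma energy_decr a b (p := 2 *: (C *m a) - C *m b) :
  energy a b - energy p a = dot (b - p) ((1%:M - C) *m (b - p)).
Proof.
have pE w : 4 * dot w (C *m a) = 2 * dot w p + 2 * dot w (C *m b).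
  by rewrite /p !dot_linear; ring.
have sym u v : dot u (C *m v) = dot v (C *m u) by rewrite dot_mulmxr Csym dotC.
have := pE b; have := pE p.
rewrite /energy (sym a b); move: p {pE} => p.
by rewrite !dot_linear !mul1mx (dotC p b) (sym b p); lra.
Qed.

(** The energy converges, so its decrements tend to 0, and with them the
    differences over two steps; [two_step_defect] then concludes since
    (1 + 3 C) (1 - C) is invertible. *)
Lemma two_step_cvg0 : mu @ \oo --> (0 : 'cV[R]_m).
Proof.
pose e k := mu k - mu k.+2.
have ID_pos : posdef (1%:M - C).
  by move=> v /Cbd/andP[_]; rewrite mulmxBl mul1mx dotDr dotNr subr_gt0.
have I3C_pos : posdef (1%:M + 3 *: C).
  move=> v /Cbd/andP[+ _]; rewrite mulmxDl mul1mx -scalemxAl dotDr dotZr; lra.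
have e0 : e @ \oo --> (0 : 'cV[R]_m).
  apply: (posdef_cvg0 _ ID_pos); first by rewrite linearB/= trmx1 Csym.
  pose V k := energy (mu k.+1) (mu k).
  have VE k : dot (e k) ((1%:M - C) *m e k) = V k - V k.+1.
    by rewrite /V mu_rec energy_decr -mu_rec.
  under eq_fun do rewrite VE.
  have cvV : cvgn V.
    apply: nonincreasing_is_cvgn.
      apply/nonincreasing_seqP => k; rewrite -subr_ge0 -VE.
      have [->|/ID_pos/ltW//] := eqVneq (e k) 0.
      by rewrite mulmx0 dot0r.
    by exists 0 => _ [k _ <-]; exact: energy_ge0.
  rewrite -(subrr (limn V)); apply: cvgB => //.
  by rewrite (cvg_shiftS V).
pose K := (1%:M + 3 *: C) *m (1%:M - C).
have KE k : K *m mu k =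
    e k + C *m e k - 4 *: (C *m (C *m e k)) + 2 *: (C *m e k.+1).
  rewrite /e (mu_rec k.+1) mu_rec; exact: two_step_defect.
have Kunit : K \in unitmx by rewrite unitmx_mul !posdef_unitmx.
have e1 : e k.+1 @[k --> \oo] --> (0 : 'cV[R]_m).
  by rewrite (cvg_shiftS e).
have Ce := cvg_mulmx (B := C) e0.
have CCe := cvg_mulmx (B := C) Ce; have Ce1 := cvg_mulmx (B := C) e1.
have : K *m mu k @[k --> \oo] -->
    0 + C *m 0 - 4 *: (C *m (C *m 0)) + 2 *: (C *m (0 : 'cV[R]_m)).
  under eq_fun do rewrite KE.
  have ZCCe : 4 *: (C *m (C *m e k)) @[k --> \oo] --> 4 *: (C *m (C *m 0)).
    exact: cvgZl_tmp.
  have ZCe1 : 2 *: (C *m e k.+1) @[k --> \oo] --> 2 *: (C *m (0 : 'cV[R]_m)).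
    exact: cvgZl_tmp.
  exact: cvgD (cvgB (cvgD e0 Ce) ZCCe) ZCe1.
rewrite !mulmx0 !scaler0 subr0 !addr0.
move/(cvg_mulmx (B := invmx K)); rewrite mulmx0.
by under eq_fun do rewrite mulKmx//.
Qed.

End TwoStepRecursion.

(** * One round in terms of the residual *)

Section ResidualProjection.
Context {R : realType} {m p : nat}.
Variable M : 'M[R]_(m, p).
Hypothesis Minj : forall v : 'cV_p, M *m v = 0 -> v = 0.

(** The orthogonal projection onto the complement of the range of M, by the
    normal equations. *)
Definition resproj : 'M[R]_m := 1%:M - M *m invmx (M^T *m M) *m M^T.

Lemma gram_unit : M^T *m M \in unitmx.
Proof.
rewrite -row_free_unit; apply: inj_row_free => v vG.
apply: trmx_inj; rewrite trmx0; apply: Minj; apply/eqP; rewrite -dot_eq0.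
have E : M^T *m (M *m v^T) = 0.
  by apply: trmx_inj; rewrite trmx0 !trmx_mul !trmxK -mulmxA.
by rewrite dot_mulmxr E dotC dot0r.
Qed.

Lemma trmx_resproj_mul : M^T *m resproj = 0.
Proof. by rewrite mulmxBr mulmx1 !mulmxA mulmxV ?gram_unit// mul1mx subrr. Qed.

Lemma resproj_orthoproj : orthoproj resproj.
Proof.
split.
  by rewrite linearB/= trmx1 !trmx_mul trmxK trmx_inv trmx_mul trmxK mulmxA.
by rewrite {1}/resproj mulmxBl mul1mx -!mulmxA trmx_resproj_mul !mulmx0 subr0.
Qed.

Lemma resproj_fixed (v : 'cV[R]_m) : resproj *m v = v -> M^T *m v = 0.
Proof. by move=> <-; rewrite mulmxA trmx_resproj_mul mul0mx. Qed.

(** By Pythagoras, F v is half of the squared norm of M (v - v') plus a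
    constant, for the least squares solution v'. So v' is a minimizer, which
    gives access to the defining property of argmin, and every minimizer has
    the same image under M as v'. *)
Lemma argmin_residual (F : 'cV[R]_p -> R) (w : 'cV[R]_m) (x0 : 'cV[R]_p) c :
  (forall v, F v = 2^-1 * dot (w + M *m (v - x0)) (w + M *m (v - x0)) + c) ->
  w + M *m (argmin F - x0) = resproj *m w.
Proof.
move=> FE; pose v' := x0 - invmx (M^T *m M) *m (M^T *m w).
have wE v : w + M *m (v - x0) = resproj *m w + M *m (v - v').
  have -> : v - v' = (v - x0) + invmx (M^T *m M) *m (M^T *m w).
    by rewrite opprB addrA addrAC.
  rewrite /resproj mulmxBl mul1mx -!mulmxA [in RHS]mulmxDr.
  by rewrite addrACA addNr addr0.
have FE' v : F v = 2^-1 * dot (resproj *m w) (resproj *m w) +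
    2^-1 * dot (M *m (v - v')) (M *m (v - v')) + c.
  have orth : dot (resproj *m w) (M *m (v - v')) = 0.
    by rewrite dot_mulmxr mulmxA trmx_resproj_mul mul0mx dotC dot0r.
  by rewrite FE wE dotDl !dotDr (dotC (M *m _) (resproj *m _)) orth; ring.
have v'min u : F v' <= F u.
  by rewrite !FE' subrr mulmx0 dot0r; have := dot_ge0 (M *m (u - v')); lra.
have : F (argmin F) <= F v'.
  by apply: (xgetPex 0 (P := [set v | forall u, F v <= F u])); exists v'.
rewrite wE !FE' subrr mulmx0 dot0r => le0.
have /eqP : dot (M *m (argmin F - v')) (M *m (argmin F - v')) = 0.
  by have := dot_ge0 (M *m (argmin F - v')); lra.
by rewrite dot_eq0 => /eqP ->; rewrite addr0.
Qed.

End ResidualProjection.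

Section Sweep.
Context {R : realType} {n : nat} {d : 'I_n -> nat}.
Let N := (\sum_i d i)%N.
Variables (A : 'M[R]_N) (b : 'cV[R]_N).
Hypothesis Aunit : A \in unitmx.
Implicit Types (x mu : 'cV[R]_N) (i : 'I_n).

Lemma mul_set_block x i (v : 'cV_(d i)) :
  A *m set_block x v = A *m x + submxrow A i *m (v - submxcol x i).
Proof.
have AE (z : 'cV_N) : A *m z = \sum_j submxrow A j *m submxcol z j.
  by rewrite -mul_mxrow_mxcol submxrowK submxcolK.
rewrite !AE (bigD1 i)//= [in RHS](bigD1 i)//= mxcolK dfwithin mulmxBr.
rewrite [RHS]addrC addrA subrK; congr (_ + _).
by apply: eq_bigr => j ji; rewrite mxcolK dfwithout// eq_sym.
Qed.

Lemma submxrow_inj i (v : 'cV_(d i)) : submxrow A i *m v = 0 -> v = 0.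
Proof.
move=> Av; have := mul_set_block 0 v; rewrite mulmx0 add0r submxcol0 subr0 Av.
move/(congr1 (mulmx (invmx A))); rewrite mulKmx// mulmx0 /set_block.
by move/(congr1 (fun z => submxcol z i)); rewrite mxcolK dfwithin submxcol0.
Qed.

Definition block_resproj i : 'M[R]_N := resproj (submxrow A i).

(** Completing the square in mu. *)
Lemma aug_lagrangian_square x mu :
  aug_lagrangian (cst 0) A b x mu =
  2^-1 * dot (A *m x - b - mu) (A *m x - b - mu) - 2^-1 * dot mu mu.
Proof.
rewrite /aug_lagrangian /lagrangian /= -/(dot _ _); set r := A *m x - b.
have -> : sqnorm2 r = dot r r.
  by rewrite dotE; apply: eq_bigr => i _; rewrite expr2.
by move: r => r; rewrite !dot_linear (dotC r mu); field.
Qed.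

Lemma minimize_block_residual mu x i :
  A *m minimize_block (cst 0) A b mu x i - b - mu =
  block_resproj i *m (A *m x - b - mu).
Proof.
rewrite /minimize_block mul_set_block.
rewrite -(argmin_residual (@submxrow_inj i) (x0 := submxcol x i)
  (c := - (2^-1 * dot mu mu)) (F := fun v : 'cV_(d i) =>
    aug_lagrangian (cst 0) A b (set_block x v) mu)); last first.
  move=> v; rewrite aug_lagrangian_square mul_set_block.
  by rewrite -!(addrAC _ (submxrow A i *m _)).
by rewrite -!(addrAC _ (submxrow A i *m _)).
Qed.

Definition sweep_mx (s : 'S_n) : 'M[R]_N :=
  \prod_(i <- rev [seq s i | i <- enum 'I_n]) block_resproj i.

Lemma sweep_residual s mu x :
  A *m sweep (cst 0) A b s mu x - b - mu = sweep_mx s *m (A *m x - b - mu).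
Proof.
rewrite /sweep /sweep_mx; elim: [seq s i | i <- _] x => [|i t IH] x /=.
  by rewrite big_nil mul1mx.
rewrite IH rev_cons -cats1 big_cat big_seq1/= -[RHS]mulmxA.
by rewrite minimize_block_residual.
Qed.

(** The new residual A x' - b - mu determines x', as A is invertible. *)
Lemma admm_roundE s (y : 'cV_(N + N)) :
  admm_round (cst 0) A b s y =
  let w := sweep_mx s *m (A *m usubmx y - b - dsubmx y) in
  col_mx (invmx A *m (b + dsubmx y + w)) (- w).
Proof.
rewrite /admm_round; set x' := sweep _ _ _ _ _ _; set mu := dsubmx y.
have /= <- := sweep_residual s mu (usubmx y); rewrite -/x' -/mu.
congr col_mx; last by rewrite !opprB addrC.
by rewrite -(addrA _ (- b)) -opprD [b + mu + _]addrC subrK mulKmx.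
Qed.

(** A vector fixed by every projection is orthogonal to every column of A. *)
Lemma block_resproj_nofix (v : 'cV_N) : v != 0 ->
  has (fun i => block_resproj i *m v != v) (enum 'I_n).
Proof.
apply: contraNT => /hasPn fixed.
have Av : A^T *m v = 0.
  rewrite -[A]submxrowK tr_mxrow mxcol_mul -(mxcol0 1); apply: eq_mxcol => i.
  apply: resproj_fixed (@submxrow_inj i) _ _.
  by have := fixed i; rewrite mem_enum => /(_ isT)/negPn/eqP.
by rewrite -[v](mulKmx (_ : A^T \in unitmx)) ?unitmx_tr// Av mulmx0.
Qed.

End Sweep.

(** * Means of random affine recursions *)

Section Mean.
Context {R : realType} {disp : measure_display} {T : measurableType disp}.
Variable P : probability T R.
Implicit Types (f g : T -> R) (a b : R).

(** Integrability is part of the notion, since the integral is additive only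
    on integrable functions. *)
Definition has_mean f a : Prop :=
  P.-integrable setT (EFin \o f) /\ (\int[P]_w (f w)%:E = a%:E)%E.

Lemma has_meanD f g a b : has_mean f a -> has_mean g b ->
  has_mean (fun w => f w + g w) (a + b).
Proof.
move=> [fi fa] [gi gb]; split.
  exact: (integrableD measurableT fi gi).
under eq_integral do rewrite EFinD.
by rewrite integralD// fa gb.
Qed.

Lemma has_meanZ f a b : has_mean f a -> has_mean (fun w => b * f w) (b * a).
Proof.
move=> [fi fa]; split.
  exact: (integrableZl measurableT b fi).
under eq_integral do rewrite EFinM.
by rewrite integralZl// fa.
Qed.

Lemma has_mean_indic (D : set T) a : measurable D -> P D = a%:E ->
  has_mean \1_D a.
Proof.
move=> mD PD; split; first exact: integrable_indic.
by rewrite integral_indic// setIT.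
Qed.

Lemma has_mean_sum (I : Type) (r : seq I) (F : I -> T -> R) (c : I -> R) :
  (forall i, has_mean (F i) (c i)) ->
  has_mean (fun w => \sum_(i <- r) F i w) (\sum_(i <- r) c i).
Proof.
move=> Fc; elim: r => [|i r IH].
  rewrite big_nil; under eq_fun do rewrite big_nil.
  split; first exact: integrable0.
  by rewrite integral0.
rewrite big_cons; under eq_fun do rewrite big_cons.
exact: has_meanD.
Qed.

Lemma has_mean_expectation f a : has_mean f a -> fine ('E_P[f])%E = a.
Proof. by rewrite unlock => -[_ ->]. Qed.

End Mean.

Section RandomAffineRecursion.
Context {R : realType} {disp : measure_display} {T : measurableType disp}.
Context {P : probability T R} {n m : nat}.
Variable sigma : nat -> T -> 'S_n.
Hypothesis hunif : forall k : nat, uniform_perm P (sigma k).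
Hypothesis hindep : independent_perms P sigma.
Variables (M : 'S_n -> 'M[R]_m) (c : 'S_n -> 'cV[R]_m).
Variable Y : nat -> T -> 'cV[R]_m.
Variable y0 : 'cV[R]_m.
Hypothesis Y0 : forall w, Y 0 w = y0.
Hypothesis YS : forall k w, Y k.+1 w = M (sigma k w) *m Y k w + c (sigma k w).

Let p : R := n`!%:R^-1.

(** The indicator of the event that sigma j = t j for all j in J, as a product,
    so that adding an index to J multiplies by one factor. *)
Definition rounds_indic (J : seq nat) (t : nat -> 'S_n) (w : T) : R :=
  \prod_(j <- J) (sigma j w == t j)%:R.

Lemma rounds_indic_mean J t : uniq J ->
  has_mean P (rounds_indic J t) (p ^+ size J).
Proof.
move=> uJ; pose D := \bigcap_(k in [set` J]) (sigma k @^-1` [set t k]).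
have -> : rounds_indic J t = \1_D.
  apply/funext => w; rewrite /rounds_indic indicE.
  have [wD|wD] := boolP (w \in D).
    rewrite big_seq big1// => j jJ; rewrite inE in wD.
    by rewrite (wD j)// eqxx.
  have /hasP[j jJ /negPf sj] : has (fun j => sigma j w != t j) J.
    apply: contraNT wD => /hasPn wD; rewrite inE => j /= jJ.
    by apply/eqP; rewrite -[_ == _]negbK; exact: wD.
  by rewrite (big_rem j)//= sj mul0r.
apply: has_mean_indic.
  apply: fin_bigcap_measurable => [|j _]; first exact: finite_seq.
  by have [] := hunif j (t j).
have := hindep (fun j => [set t j]) uJ; rewrite -/D => ->.
under eq_bigr do rewrite (hunif _ _).2.
by rewrite prodEFin big_const_seq count_predT -Monoid.iteropE.
Qed.

Fixpoint mean_iter k : 'cV[R]_m :=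
  if k is k'.+1 then
    p *: \sum_s (M s *m mean_iter k' + c s)
  else y0.

Lemma rounds_indic_cons J t k s w : k \notin J ->
  rounds_indic (k :: J) (fun j => if j == k then s else t j) w =
  (sigma k w == s)%:R * rounds_indic J t w.
Proof.
move=> kJ; rewrite /rounds_indic big_cons eqxx; congr (_ * _).
by apply: eq_big_seq => j jJ; case: (eqVneq j k) => // jk; rewrite -jk jJ in kJ.
Qed.

(** Independence of the iterate Y k from the rounds k, k + 1, ..., in the form
    in which it can be proved by induction on k: splitting according to the
    value of sigma k turns a statement on Y (k + 1) and the rounds in J into
    statements on Y k and the rounds in k :: J. *)
Lemma mean_iterP k J t i : uniq J -> all (leq k) J ->
  has_mean P (fun w => rounds_indic J t w * Y k w i 0)
    (p ^+ size J * mean_iter k i 0).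
Proof.
elim: k J t i => [|k IH] J t i uJ kJ.
  rewrite mulrC; under eq_fun do rewrite Y0 mulrC.
  exact/has_meanZ/rounds_indic_mean.
have kJ' : k \notin J.
  by apply/negP => /(allP kJ); rewrite ltnn.
pose J' := k :: J; pose t' s j := if j == k then s else t j.
have uJ' : uniq J' by rewrite /= kJ'.
have allJ' : all (leq k) J'.
  by rewrite /= leqnn; apply: sub_all kJ => j; exact: ltnW.
have -> : (fun w => rounds_indic J t w * Y k.+1 w i 0) = (fun w =>
    \sum_s (\sum_j M s i j * (rounds_indic J' (t' s) w * Y k w j 0) +
      c s i 0 * rounds_indic J' (t' s) w)).
  apply/funext => w; rewrite (bigD1 (sigma k w))//= [X in _ + X]big1 ?addr0.
    rewrite !rounds_indic_cons// eqxx mul1r YS mxE [X in _ * (X + _)]mxE.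
    rewrite mulrDr mulr_sumr [in RHS]mulrC; congr (_ + _).
    by apply: eq_bigr => j _; rewrite mulrCA.
  move=> s /negPf sk; rewrite !rounds_indic_cons// eq_sym sk.
  by rewrite !mul0r mulr0 addr0 big1// => j _; rewrite mul0r mulr0.
have -> : p ^+ size J * mean_iter k.+1 i 0 =
    \sum_s (\sum_j M s i j * (p ^+ size J' * mean_iter k j 0) +
      c s i 0 * p ^+ size J').
  rewrite /= mxE mulrA -exprSr summxE mulr_sumr; apply: eq_bigr => s _.
  rewrite mxE [X in _ * (X + _)]mxE mulrDr mulr_sumr [in RHS]mulrC.
  by congr (_ + _); apply: eq_bigr => j _; rewrite mulrCA.
apply: has_mean_sum => s; apply: has_meanD.
  by apply: has_mean_sum => j; apply: has_meanZ; exact: IH.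
by apply: has_meanZ; exact: rounds_indic_mean.
Qed.

Lemma expectation_vec_iter k : expectation_vec P (Y k) = mean_iter k.
Proof.
apply/colP => i; rewrite mxE; apply: has_mean_expectation.
have := @mean_iterP k [::] (fun=> 1%g) i isT isT.
rewrite expr0 mul1r; congr has_mean.
by apply/funext => w; rewrite /rounds_indic big_nil mul1r.
Qed.

End RandomAffineRecursion.

(** * Optimality and convergence of the mean iterates *)

(** The dual function vanishes at 0 and is at most 0 everywhere, because the
    Lagrangian vanishes at the feasible point. At x = A^-1 (b + mu) the
    Lagrangian is - |mu|^2, so only mu = 0 attains the maximum. *)
Lemma primal_dual_optimal_cst0 (R : realType) N (A : 'M[R]_N)
    (b x mu : 'cV[R]_N) : A \in unitmx ->
  primal_dual_optimal (cst 0) A b x mu <-> x = invmx A *m b /\ mu = 0.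
Proof.
move=> Aunit; have Axb : A *m (invmx A *m b) = b by rewrite mulKVmx.
have dual0 : dual_function (cst 0) A b 0 = 0%E.
  rewrite /dual_function (_ : [set _ | _ in _] = [set 0%E]) ?ereal_inf1//.
  apply/seteqP; split=> [_ [z _ <-]|_ ->]/=.
    by rewrite /lagrangian trmx0 mul0mx mxE subr0.
  by exists 0 => //; rewrite /lagrangian trmx0 mul0mx mxE subr0.
split=> [[[Ax _] mu_opt]|[-> ->]].
  split; first by rewrite -Ax mulKmx.
  have lb z : (0 <= (lagrangian (cst 0) A b z mu)%:E)%E.
    rewrite -dual0; apply: le_trans (mu_opt 0) _.
    by apply: ereal_inf_lbound; exists z.
  have := lb (invmx A *m (b + mu)).
  rewrite lee_fin /lagrangian/= mulKVmx// (addrC b) addrK.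
  rewrite -/(dot mu mu) sub0r oppr_ge0 => mu0.
  by apply/eqP; rewrite -dot_eq0 eq_le mu0 dot_ge0.
split=> [|mu']; first by split.
rewrite dual0; apply: ereal_inf_lbound; exists (invmx A *m b) => //.
by rewrite /lagrangian Axb subrr mulmx0 mxE subrr.
Qed.

Section MeanDynamics.
Context {R : realType} {n : nat} {d : 'I_n -> nat}.
Let N := (\sum_i d i)%N.
Variables (A : 'M[R]_N) (b : 'cV[R]_N).
Hypothesis Aunit : A \in unitmx.

Let C : 'M[R]_N := perm_avg (block_resproj A) (enum 'I_n).

Let G : 'M[R]_(N + N, N) := col_mx (invmx A) (- 1%:M).

(** Isolates the dependence on s, which is linear in the matrix of the sweep;
    averaging over s then just averages that matrix. *)
Lemma admm_round_residual s (y : 'cV_(N + N)) :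
  admm_round (cst 0) A b s y = col_mx (invmx A *m (b + dsubmx y)) 0 +
    G *m (sweep_mx A s *m (A *m usubmx y - b - dsubmx y)).
Proof.
rewrite admm_roundE//= mul_col_mx add_col_mx -mulmxDr.
by rewrite mulNmx mul1mx add0r.
Qed.

Definition round_mx (s : 'S_n) : 'M[R]_(N + N) :=
  block_mx 0 (invmx A) 0 0 + G *m sweep_mx A s *m row_mx A (- 1%:M).

Definition round_cst (s : 'S_n) : 'cV[R]_(N + N) :=
  col_mx (invmx A *m b) 0 - G *m sweep_mx A s *m b.

Lemma admm_round_affine s (y : 'cV_(N + N)) :
  admm_round (cst 0) A b s y = round_mx s *m y + round_cst s.
Proof.
rewrite admm_round_residual /round_mx /round_cst.
rewrite -[y in RHS]vsubmxK mulmxDl mul_block_col !mul0mx !add0r.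
rewrite -[_ *m row_mx _ _ *m _]mulmxA mul_row_col mulNmx mul1mx.
rewrite addrACA add_col_mx addr0 -mulmxDr [dsubmx y + b]addrC; congr (_ + _).
by rewrite -mulmxBr mulmxA addrAC.
Qed.

Lemma mean_admm_round (y : 'cV_(N + N)) :
  n`!%:R^-1 *: \sum_s admm_round (cst 0) A b s y =
  let w := C *m (A *m usubmx y - b - dsubmx y) in
  col_mx (invmx A *m (b + dsubmx y + w)) (- w).
Proof.
rewrite (eq_bigr _ (fun s _ => admm_round_residual s y)) big_split/= scalerDr.
rewrite sumr_const card_Sn -[col_mx _ _ *+ _]scaler_nat scalerA.
rewrite mulVf ?scale1r; last first.
  by rewrite pnatr_eq0 -lt0n fact_gt0.
rewrite -mulmx_sumr -mulmx_suml scalemxAr scalemxAl -perm_avg_enum -/C.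
by rewrite mul_col_mx add_col_mx -mulmxDr mulNmx mul1mx add0r.
Qed.

(** Since A x_(k+1) - b = mu_k - mu_(k+1), the mean multipliers obey the
    two-step recursion of [two_step_cvg0], and they determine the mean primal
    iterates. *)
Lemma mean_iter_cvg (y0 : 'cV_(N + N)) :
  mean_iter round_mx round_cst y0 @ \oo --> col_mx (invmx A *m b) 0.
Proof.
set phi := mean_iter _ _ _.
have phiS k : phi k.+1 = let w :=
    C *m (A *m usubmx (phi k) - b - dsubmx (phi k)) in
    col_mx (invmx A *m (b + dsubmx (phi k) + w)) (- w).
  rewrite -mean_admm_round /=; congr (_ *: _).
  by apply: eq_bigr => s _; rewrite admm_round_affine.
pose mu k := dsubmx (phi k).
have muS k : mu k.+1 = - (C *m (A *m usubmx (phi k) - b - mu k)).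
  by rewrite /mu phiS/= col_mxKd.
have xS k : usubmx (phi k.+1) = invmx A *m (b + mu k - mu k.+1).
  by rewrite muS phiS/= col_mxKu opprK.
have [[Csym _] Cbd] := perm_avg_sandwich (enum_uniq 'I_n)
  (fun i => resproj_orthoproj (submxrow_inj Aunit (i := i))).
have mu0 : mu @ \oo --> (0 : 'cV[R]_N).
  apply: (two_step_cvg0 Csym) => [v v0|k].
    by apply: Cbd; exact: block_resproj_nofix.
  rewrite muS xS mulKVmx// scalemxAr -mulmxN -mulmxBr; congr (C *m _).
  by move: (mu k.+1) (mu k) => z1 z0; apply/colP => i; rewrite !mxE; ring.
rewrite -(cvg_shiftS phi).
have muS0 : mu k.+1 @[k --> \oo] --> (0 : 'cV[R]_N) by rewrite (cvg_shiftS mu).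
have -> : [sequence phi n.+1]_n = fun k => col_mx (invmx A *m b) 0 +
    col_mx (invmx A) 0 *m mu k + col_mx (- invmx A) 1%:M *m mu k.+1.
  apply/funext => k /=; rewrite -[LHS]vsubmxK xS.
  rewrite !mul_col_mx !add_col_mx mulmxBr mulmxDr mulNmx mul0mx mul1mx.
  by rewrite !add0r.
have h1 : col_mx (invmx A) 0 *m mu k @[k --> \oo] -->
    (0 : 'cV[R]_(N + N)).
  by rewrite -(mulmx0 _ (col_mx (invmx A) 0)); exact: cvg_mulmx.
have h2 : col_mx (- invmx A) 1%:M *m mu k.+1 @[k --> \oo] -->
    (0 : 'cV[R]_(N + N)).
  by rewrite -(mulmx0 _ (col_mx (- invmx A) 1%:M)); exact: cvg_mulmx.
have := cvgD (cvgD (cvg_cst (col_mx (invmx A *m b) 0)) h1) h2.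
by rewrite !addr0; apply.
Qed.

End MeanDynamics.

Unset Implicit Arguments.

Theorem theorem1 (R : realType) (n : nat) (d : 'I_n -> nat)
    (A_ : forall i : 'I_n, 'M[R]_((\sum_i d i)%N, d i))
    (A : 'M[R]_((\sum_i d i)%N)) (hA : A = \mxrow_(i < n) A_ i)
    (hns : A \in unitmx)
    (b : 'cV[R]_((\sum_i d i)%N))
    (y0 : 'cV[R]_((\sum_i d i) + (\sum_i d i))%N)
    (disp : measure_display) (T : measurableType disp) (P : probability T R)
    (sigma : nat -> T -> 'S_n)
    (hunif : forall k : nat, uniform_perm P (sigma k))
    (hindep : independent_perms P sigma) :
  (forall x mu : 'cV[R]_((\sum_i d i)%N),
     primal_dual_optimal (cst 0) A b x mu <-> x = invmx A *m b /\ mu = 0) /\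
  (fun k : nat => expectation_vec P
     (fun w => rp_admm (cst 0) A b (fun j => sigma j w) y0 k))
    @ \oo --> col_mx (invmx A *m b) 0.
Proof.
split=> [x mu|]; first exact: primal_dual_optimal_cst0.
rewrite [X in X @ _ --> _](_ : _ = mean_iter (round_mx A) (round_cst A b) y0).
  exact: mean_iter_cvg.
apply/funext => k.
apply: (@expectation_vec_iter _ _ _ _ _ _ sigma hunif hindep _ _
  (fun k w => rp_admm (cst 0) A b (fun j => sigma j w) y0 k)) => // j w.
exact: admm_round_affine.
Qed.
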